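(* Let $\mu\in\mathbb{R}$, let $B_1^{\mu}$ be a one-dimensional Brownian motion with drift $\mu$ and let $B_2$ be a standard one-dimensional Brownian motion independent of $B_1^\mu$. The density of the process $I^{\mu}(t)=B_1^{\mu}(|B_2(t)|)$, $t>0$, given by $$p_I^{\mu}(x,t)=2\int_0^{\infty}\frac{e^{-\frac{(x-\mu s)^2}{2s}}}{\sqrt{2\pi s}}\,\frac{e^{-\frac{s^2}{2t}}}{\sqrt{2\pi t}}\,ds,$$ is a solution to the equation $$\frac{\partial}{\partial t}p(x,t)=\frac12\left(\frac12\frac{\partial^2}{\partial x^2}-\mu\frac{\partial}{\partial x}\right)^2p(x,t)+\frac{1}{\sqrt{2\pi t}}\left(\frac12\frac{d^2}{dx^2}-\mu\frac{d}{dx}\right)\delta(x),\qquad x\in\mathbb{R},\ t>0,$$ with initial condition $p(x,0)=\delta(x)$.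
   Context: $\delta$ is the Dirac delta function and its derivatives are those of generalized functions. The Brownian motion with drift $B_1^\mu(s)$ has transition density $\frac{1}{\sqrt{2\pi s}}e^{-(x-\mu s)^2/(2s)}$. The square of the differential operator means the operator composed with itself. *)

(* Defs.v *)
From HB Require Import structures.
From mathcomp Require Import all_boot all_order all_algebra.
From mathcomp Require Import all_classical all_reals all_analysis.

Set Implicit Arguments.
Unset Strict Implicit.
Unset Printing Implicit Defensive.

Import Order.TTheory GRing.Theory Num.Theory.
Import numFieldNormedType.Exports.

Local Open Scope classical_set_scope.
Local Open Scope ring_scope.

(* A process is a map X : R -> T -> R, of which only the times t >= 0 are
   relevant. *)
Section processes.
Context {d : measure_display} {T : measurableType d} {R : realType}.
Variable P : probability T R.
Implicit Types (X Y : R -> T -> R) (f : R -> R).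

(* The choice A i = setT makes factors trivial, so the product rule over all
   the increments contains the one over every subfamily of them. *)
Definition independent_increments X : Prop :=
  forall (n : nat) (t : nat -> R) (A : nat -> set R),
    0 <= t 0%N -> (forall i, t i < t i.+1) -> (forall i, measurable (A i)) ->
    P (\bigcap_(i in `I_n) ((fun w => X (t i.+1) w - X (t i) w) @^-1` A i)) =
    (\prod_(i < n) P ((fun w => X (t i.+1) w - X (t i) w)%R @^-1` A i))%E.

(* The second parameter of normal_prob is the standard deviation. *)
Definition brownian_motion (m : R) X : Prop :=
  [/\ forall t, 0 <= t -> measurable_fun setT (X t),
      forall w, X 0 w = 0,
      forall w, {within `[0, +oo[, continuous (fun t => X t w)},
      independent_increments X &
      forall s t, 0 <= s -> s < t -> forall A, measurable A ->
        P ((fun w => X t w - X s w) @^-1` A) =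
        normal_prob (m * (t - s)) (Num.sqrt (t - s)) A].

Definition generated_events X : set (set T) :=
  <<s [set E | exists t A, [/\ 0 <= t, measurable A & E = X t @^-1` A]] >>.

Definition independent_processes X Y : Prop :=
  forall E F, generated_events X E -> generated_events Y F ->
    P (E `&` F) = (P E * P F)%E.

Definition has_density (Z : T -> R) f : Prop :=
  [/\ measurable_fun setT Z, measurable_fun setT f, forall x, 0 <= f x &
      forall A, measurable A ->
        P (Z @^-1` A) = (\int[lebesgue_measure]_(x in A) (f x)%:E)%E].

End processes.

Section generalized_functions.
Context {R : realType}.

Definition test_function (phi : R -> R) : Prop :=
  (forall n x, derivable (phi^`(n))%classic x 1) /\
  compact (closure [set x | phi x != 0]).

(* Generalized functions are given by their values on the test functions; all
   notions below only evaluate them there (phi^`() is a test function when phi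
   is one). The functionals used are built from locally integrable functions
   and the Dirac delta, so they are linear and continuous on test functions.
   R^o makes the linear combinations of functionals available. *)
Definition genfun : Type := (R -> R) -> R^o.

Definition regular (f : R -> R) : genfun :=
  fun phi => \int[lebesgue_measure]_x (f x * phi x).

Definition delta : genfun := fun phi => phi 0.

Definition gderiv (u : genfun) : genfun := fun phi => - u (phi^`())%classic.

(* Derivative in the parameter t of a family of generalized functions of x, in
   the weak topology. *)
Definition is_time_gderiv (U : R -> genfun) (t : R) (v : genfun) : Prop :=
  forall phi, test_function phi ->
    is_derive t 1 (fun s => (U s phi : R)) (v phi : R).

Definition initial_gvalue (U : R -> genfun) (v : genfun) : Prop :=
  forall phi, test_function phi -> (U t phi : R) @[t --> 0^'+] --> (v phi : R).

Definition drift_op (m : R) (u : genfun) : genfun :=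
  2^-1 *: gderiv (gderiv u) - m *: gderiv u.

End generalized_functions.

Definition p_I {R : realType} (mu x t : R) : R :=
  2 * \int[lebesgue_measure]_(s in `]0, +oo[)
        (expR (- ((x - mu * s) ^+ 2 / (2 * s))) / Num.sqrt (2 * pi * s)
         * (expR (- (s ^+ 2 / (2 * t))) / Num.sqrt (2 * pi * t))).

(* Main.v *)
Require Import Defs.
From HB Require Import structures.
From mathcomp Require Import all_boot all_order all_algebra.
From mathcomp Require Import ring lra.
From mathcomp Require Import all_classical all_reals all_analysis.
From mathcomp Require Import measurable_realfun.

Set Implicit Arguments.
Unset Strict Implicit.
Unset Printing Implicit Defensive.

Import Order.TTheory GRing.Theory Num.Theory.
Import numFieldNormedType.Exports.

Local Open Scope classical_set_scope.
Local Open Scope ring_scope.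

(* Let [phi] be a test function and [L = (1/2) d^2/dx^2 + m d/dx] the formal
   adjoint of the drift operator. Pairing [p_I] with [phi] gives, by Tonelli,
   [V_phi(t) = E g_phi(|N(0,t)|)] with [g_phi(s) = E phi(m s + sqrt s N(0,1))].
   Differentiating under the integral and integrating by parts against the
   Gaussian weight (Stein's identity) yields [g_phi' = g_(L phi)] on [s > 0].
   The same computation on the half line, now with a boundary term at [0],
   yields [V_phi'(t) = V_(L L phi)(t) / 2 + (L phi)(0) / sqrt(2 pi t)]; the
   boundary term is the source supported at the origin. Continuity of [V_phi]
   at [0] is the initial condition.

   For the law of [B1(|B2(t)|)], the random time [|B2(t)|] is approximated from
   above by times [S_n] in the grid of step [1/n]. Independence makes
   [P(B1(S_n) in A)] an explicit mixture of normal laws, converging to the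
   integral of [p_I] over [A] when [A] is an open ray; path continuity gives
   [P(B1(|B2(t)|) in A) <= lim P(B1(S_n) in A)]. As both sides are
   probabilities, the inequalities on left and right rays are equalities. *)

(** * Integrals against the standard normal density *)

Section integration.
Context {R : realType}.
Local Notation leb := (@lebesgue_measure R).

(** The integrand may change sign, so the half line is exhausted by the intervals []a, b n]] under
    dominated convergence with dominating function [|f|], and the ordinary fundamental theorem is
    applied on each of them. *)
Lemma Rintegral_continuous_FTC2y (f F : R -> R) (a l : R) :
  continuous f -> leb.-integrable `]a, +oo[ (EFin \o f) ->
  (forall x, a < x -> is_derive x 1 F (f x)) -> F x @[x --> a^'+] --> F a ->
  F x @[x --> +oo] --> l ->
  \int[leb]_(x in `]a, +oo[) f x = l - F a.
Proof.
move=> cf intf dF Fa Fl.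
have mf : measurable_fun [set: R] f by exact: continuous_measurable_fun.
pose b (n : nat) := a + n.+1%:R.
have ab n : a < b n by rewrite ltrDl.
have by_ : b n @[n --> \oo] --> +oo.
  apply/cvgryPge => A; near=> n; rewrite /b -lerBlDl.
  apply: (@le_trans _ _ n%:R); last by rewrite ler_nat.
  by near: n; exact: nbhs_infty_ger.
pose fn n := (EFin \o f) \_ `]a, b n].
have cvgn : (\int[leb]_(x in `]a, +oo[) fn n x @[n --> \oo] -->
    \int[leb]_(x in `]a, +oo[) (EFin \o f) x)%E.
  apply: (@dominated_cvg _ _ _ leb _ _ fn (EFin \o f) (abse \o (EFin \o f))) => //=.
  - by move=> n; apply/measurable_restrict => //; exact/measurable_EFinP/measurable_funTS.
  - move=> x; rewrite in_itv/= andbT => ax.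
    apply: cvg_near_cst; near=> n.
    rewrite /fn patchE mem_set//= in_itv/= ax/=.
    by near: n; move/cvgryPge : by_; exact.
  - exact: integrable_abse.
  - move=> n x _; rewrite /fn patchE; case: ifPn => //= _.
    by rewrite normr0 lee_fin.
have fnE n : (\int[leb]_(x in `]a, +oo[) fn n x = (F (b n) - F a)%:E)%E.
  rewrite /fn -integral_mkcondr setIidr; last first.
    by move=> x /=; rewrite !in_itv/= andbT => /andP[].
  rewrite integral_itv_obnd_cbnd//; last exact/measurable_EFinP/measurable_funTS.
  rewrite EFinB; apply: continuous_FTC2 => //.
  - exact: continuous_subspaceT.
  - split => //.
    + by move=> x; rewrite in_itv/= => /andP[ax _]; have := dF _ ax => -[].
    + apply: cvg_at_left_filter.
      apply: differentiable_continuous; apply/derivable1_diffP.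
      by have := dF _ (ab n) => -[].
  - move=> x; rewrite in_itv/= => /andP[ax _].
    by rewrite derive1E; have := dF _ ax => dFx; rewrite derive_val.
rewrite /Rintegral.
suff -> : (\int[leb]_(x in `]a, +oo[) (f x)%:E = (l - F a)%:E)%E by [].
apply/esym/(cvg_unique _ _ cvgn) => //.
rewrite (funext fnE : (fun n => \int[leb]_(x in `]a, +oo[) fn n x)%E = _).
apply: cvg_EFin; first exact: nearW.
apply: cvgB; last exact: cvg_cst.
exact: (cvg_comp _ F by_ Fl).
Unshelve. all: by end_near. Qed.

End integration.

Lemma integrable_boundedMr d (T : measurableType d) (R : realType)
    (m : {measure set T -> \bar R}) (D : set T) (h k : T -> R) (M : R) :
  measurable D -> measurable_fun D h -> (forall x, D x -> `|h x| <= M) ->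
  m.-integrable D (EFin \o k) -> m.-integrable D (EFin \o (fun x => h x * k x)).
Proof.
move=> mD mh hM ik.
rewrite (_ : EFin \o _ = (EFin \o h) \* (EFin \o k))%E; last first.
  by apply/funext => x /=; rewrite EFinM.
apply: integrableMr => //.
exists M; split; first by rewrite num_real.
by move=> r Mr x Dx; apply: (le_trans (hM _ Dx)); exact: ltW.
Qed.

Section standard_normal.
Context {R : realType}.
Local Notation leb := (@lebesgue_measure R).
Local Notation phi := (normal_pdf (0 : R) 1).

Lemma normal_pdf01E z : phi z = normal_peak 1 * expR (- (z ^+ 2 / 2)).
Proof.
rewrite normal_pdfE ?oner_eq0// /normal_fun subr0 expr1n.
by rewrite -[1 *+ 2]/(2%:R) mulNr.
Qed.

Lemma is_derive_normal_pdf01 (z : R) : is_derive z 1 phi (- (z * phi z)).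
Proof.
have phiE : phi = normal_peak 1 \*: (expR \o (- (2^-1 \*: (@id R ^+ 2)))).
  apply/funext => x; rewrite normal_pdf01E /=; congr (_ * expR _).
  by rewrite !fctE /= /GRing.scale/= mulrC.
rewrite [X in is_derive _ _ X]phiE.
have d1 : is_derive z 1 (2^-1 \*: (@id R ^+ 2)) z.
  apply: is_derive_eq.
  by rewrite /GRing.scale/= expr1; field.
have d2 : is_derive z 1 (- (2^-1 \*: (@id R ^+ 2))) (- z).
  apply: is_deriveN.
apply: is_derive_eq.
rewrite normal_pdf01E !fctE /= /GRing.scale/= (mulrC 2^-1); ring.
Qed.

(** Trading the factor [|z|] for a wider Gaussian: after cancellation the claim is
    [|z| <= expR (3 / 8 * z ^+ 2)], which follows from [1 + x <= expR x]. It gives both the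
    integrability of [z * phi z] and the decay of [phi] at infinity. *)
Lemma normal_pdf01_le z :
  `|z| * phi z <= normal_peak 1 / normal_peak 2 * normal_pdf 0 2 z.
Proof.
rewrite normal_pdf01E normal_pdfE ?pnatr_eq0//= /normal_fun subr0.
rewrite [in leRHS]mulrA divfK ?gt_eqF ?normal_peak_gt0 ?pnatr_eq0//.
rewrite mulrCA ler_wpM2l ?normal_peak_ge0//.
rewrite -ler_pdivlMr ?expR_gt0// -expRN -expRD.
apply: le_trans (expR_ge1Dx _).
rewrite -[z ^+ 2]real_normK ?num_real// -[X in _ / X]mulr_natr.
(* Completing the square in [1 + 3 / 8 * u ^+ 2 - u] with [u = |z|]. *)
rewrite -subr_ge0 [leRHS](_ : _ = 3 / 8 * (`|z| - 4 / 3) ^+ 2 + 3^-1); last by field.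
have := sqr_ge0 (`|z| - 4 / 3); set u := (_ ^+ 2); lra.
Qed.

Lemma integrable_id_normal_pdf01 (D : set R) : measurable D ->
  leb.-integrable D (EFin \o (fun z => z * phi z)).
Proof.
have h : leb.-integrable setT (fun z =>
    (normal_peak 1 / normal_peak 2)%:E * (normal_pdf 0 2 z)%:E)%E.
  by apply: integrableZl => //; exact: integrable_normal_pdf.
move=> mD; apply: (@integrableS _ _ _ _ setT) => //.
apply: le_integrable h => //.
- apply/measurable_EFinP/measurable_funM => //.
  exact: measurable_normal_pdf.
- move=> z _ /=; rewrite lee_fin normrM (ger0_norm (normal_pdf_ge0 _ _ _)).
  by rewrite (le_trans (normal_pdf01_le z))// ler_norm.
Qed.

Lemma cvg_normal_pdf01_y : phi z @[z --> +oo] --> 0.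
Proof.
pose C := normal_peak 1 / normal_peak 2 * normal_peak (2 : R).
apply: (@squeeze_cvgr _ _ _ _ (cst 0) (fun z => C * z^-1)).
- near=> z; rewrite normal_pdf_ge0/= ler_pdivlMr; last first.
    by near: z; exact: nbhs_pinfty_gt.
  rewrite mulrC (le_trans (ler_wpM2r _ (ler_norm z))) ?normal_pdf_ge0//.
  rewrite (le_trans (normal_pdf01_le z))// ler_wpM2l//.
    by rewrite divr_ge0// normal_peak_ge0.
  by rewrite normal_pdf_ub// pnatr_eq0.
- exact: cvg_cst.
- rewrite -(mulr0 C); apply: cvgMl_tmp.
  apply/(@gtr0_cvgV0 _ _ _ _ (fun x : R => x)) => //.
  by near=> z; near: z; exact: nbhs_pinfty_gt.
Unshelve. all: by end_near. Qed.

End standard_normal.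

(** * Gaussian averages: integration by parts and dependence on a parameter *)

Section gaussian_averages.
Context {R : realType}.
Local Notation leb := (@lebesgue_measure R).
Local Notation phi := (normal_pdf (0 : R) 1).

Lemma continuous_affine (c s : R) : continuous (fun z : R => c + s * z).
Proof. by move=> z; apply: cvgD; [exact: cvg_cst|exact: mulrl_continuous]. Qed.

Lemma is_derive_affine (c s z : R) : is_derive z 1 (fun z : R => c + s * z) s.
Proof.
have -> : (fun z : R => c + s * z) = cst c + s \*: id by apply/funext.
by apply: is_derive_eq; rewrite add0r /GRing.scale/= mulr1.
Qed.

Lemma measurable_comp_affine (h : R -> R) (c s : R) (D : set R) :
  continuous h -> measurable_fun D (fun z => h (c + s * z)).
Proof.
move=> ch; apply: measurable_funTS; apply: continuous_measurable_fun => z.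
by apply: continuous_comp; [exact: continuous_affine|exact: ch].
Qed.

Lemma integrable_phi (D : set R) : measurable D -> leb.-integrable D (EFin \o phi).
Proof.
by move=> mD; apply: (@integrableS _ _ _ _ setT) => //; exact: integrable_normal_pdf.
Qed.

Lemma integrable_affine (h : R -> R) (C c s : R) (D : set R) : measurable D ->
  continuous h -> (forall x, `|h x| <= C) ->
  leb.-integrable D (EFin \o (fun z => h (c + s * z) * phi z)).
Proof.
move=> mD ch hC; apply: (@integrable_boundedMr _ _ _ _ _ _ _ C) => //.
- exact: measurable_comp_affine.
- exact: integrable_phi.
Qed.

Lemma integrable_affine_id (h : R -> R) (C c s : R) (D : set R) : measurable D ->
  continuous h -> (forall x, `|h x| <= C) ->
  leb.-integrable D (EFin \o (fun z => h (c + s * z) * (z * phi z))).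
Proof.
move=> mD ch hC; apply: (@integrable_boundedMr _ _ _ _ _ _ _ C) => //.
- exact: measurable_comp_affine.
- exact: integrable_id_normal_pdf01.
Qed.

(** Since [phi' = - z phi], the function [k (c + s * z) * phi z] has derivative
    [s * k' * phi - k * z * phi]; it vanishes at infinity because [k] is bounded. The derivative of
    [k] is asked for only beyond [a], because the lemma is later applied to [heat h] with [a = 0],
    and [heat h] is differentiated at positive times only. *)
Lemma gauss_by_parts (k k' : R -> R) (C a c s : R) :
  continuous k -> continuous k' ->
  (forall x, `|k x| <= C) -> (forall x, `|k' x| <= C) ->
  (forall z, a < z -> is_derive (c + s * z) 1 k (k' (c + s * z))) ->
  \int[leb]_(z in `]a, +oo[) (k (c + s * z) * (z * phi z)) =
  k (c + s * a) * phi a + s * \int[leb]_(z in `]a, +oo[) (k' (c + s * z) * phi z).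
Proof.
move=> ck ck' kC k'C dk.
have cphi : continuous phi by apply: continuous_normal_pdf; rewrite oner_eq0.
have i1 : leb.-integrable `]a, +oo[ (EFin \o (fun z => k' (c + s * z) * phi z)).
  exact: (integrable_affine (C := C)).
have i2 : leb.-integrable `]a, +oo[ (EFin \o (fun z => k (c + s * z) * (z * phi z))).
  exact: (integrable_affine_id (C := C)).
have is1 : leb.-integrable `]a, +oo[
    (EFin \o (fun z => s * (k' (c + s * z) * phi z))).
  exact: (integrableZl _ s i1).
suff /eqP : \int[leb]_(z in `]a, +oo[)
    (s * (k' (c + s * z) * phi z) - k (c + s * z) * (z * phi z)) =
    0 - k (c + s * a) * phi a.
  rewrite RintegralB// RintegralZl// sub0r subr_eq => /eqP ->.
  by ring.
apply: (@Rintegral_continuous_FTC2y R _ (fun z => k (c + s * z) * phi z)).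
- move=> z; apply: cvgB.
    apply: cvgM; first exact: cvg_cst.
    apply: cvgM; last exact: cphi.
    by apply: continuous_comp; [exact: continuous_affine|exact: ck'].
  apply: cvgM.
    by apply: continuous_comp; [exact: continuous_affine|exact: ck].
  by apply: cvgM; [exact: cvg_id|exact: cphi].
- rewrite (_ : EFin \o _ = (EFin \o (fun z => s * (k' (c + s * z) * phi z))%R) \-
     (EFin \o (fun z => k (c + s * z) * (z * phi z))%R))%E; last first.
    by apply/funext => z /=; rewrite EFinB.
  exact: integrableB.
- move=> z az.
  have dkz := dk _ az.
  have d1 := is_derive_affine c s z.
  have d2 : is_derive z 1 (k \o (fun z => c + s * z)) (k' (c + s * z) * s).
    exact: is_derive1_comp.
  have dphi := is_derive_normal_pdf01 z.
  have := is_deriveM d2 dphi.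
  move/is_derive_eq; apply.
  by rewrite /GRing.scale/=; ring.
- apply: cvg_at_right_filter; apply: cvgM; last exact: cphi.
  by apply: continuous_comp; [exact: continuous_affine|exact: ck].
- have h0 : C * phi z @[z --> +oo] --> C * 0.
    by apply: cvgMl_tmp; exact: cvg_normal_pdf01_y.
  rewrite mulr0 in h0.
  apply: norm_cvg0.
  apply: (squeeze_cvgr _ (cvg_cst 0) h0).
  near=> z; rewrite normr_ge0/= normrM (ger0_norm (normal_pdf_ge0 _ _ _)).
  by rewrite ler_wpM2r ?normal_pdf_ge0.
Unshelve. all: by end_near. Qed.

Lemma continuous_gauss (h b sg : R -> R) (C : R) (D : set R) : measurable D ->
  continuous h -> (forall x, `|h x| <= C) -> continuous b -> continuous sg ->
  continuous (fun t => \int[leb]_(z in D) (h (b t + sg t * z) * phi z)).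
Proof.
move=> mD ch hC cb cs t.
have tI : t \in (`]t - 1, t + 1[%classic : set R).
  by rewrite inE/= in_itv/= ltrBlDr ltrDl ltr01.
apply: (@continuity_under_integral R _ _ leb
  (fun t z => h (b t + sg t * z) * phi z) D mD (t - 1) (t + 1) _ _
   (fun z => C * phi z) _ _ t tI) => //=.
- by move=> x _; exact: (integrable_affine (C := C)).
- apply: aeW => z Dz x _; apply: cvgM; last exact: cvg_cst.
  apply: (continuous_comp (f := fun t => b t + sg t * z)); last exact: ch.
  by apply: cvgD; [exact: cb|apply: cvgM; [exact: cs|exact: cvg_cst]].
- exact: (integrableZl _ C (integrable_phi _)).
- move=> x _; apply: aeW => z Dz.
  rewrite normrM (ger0_norm (normal_pdf_ge0 _ _ _)).
  by rewrite ler_wpM2r ?normal_pdf_ge0.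
Qed.

(** Differentiation under the integral sign. The general [m] and [D] let one statement serve twice:
    with the drift on the whole line for [heat], and with drift [0] on the half line for
    [heat_avg]. *)
Lemma is_derive_gauss (h k : R -> R) (C m t : R) (D : set R) : measurable D ->
  0 < t -> continuous h -> continuous k ->
  (forall x, `|h x| <= C) -> (forall x, `|k x| <= C) ->
  (forall s z : R, 0 < s -> D z ->
    is_derive (m * s + Num.sqrt s * z) 1 h (k (m * s + Num.sqrt s * z))) ->
  is_derive t 1 (fun t => \int[leb]_(z in D) (h (m * t + Num.sqrt t * z) * phi z))
   (m * \int[leb]_(z in D) (k (m * t + Num.sqrt t * z) * phi z) +
    (2 * Num.sqrt t)^-1 *
      \int[leb]_(z in D) (k (m * t + Num.sqrt t * z) * (z * phi z))).
Proof.
move=> mD t0 ch ck hC kC dh.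
have C0 : 0 <= C by exact: le_trans (hC 0).
pose f (s z : R) := h (m * s + Num.sqrt s * z) * phi z.
pose df (s z : R) := k (m * s + Num.sqrt s * z) * (m + (2 * Num.sqrt s)^-1 * z) * phi z.
have dfE (s z : R) : 0 < s -> D z -> is_derive s 1 (f ^~ z) (df s z).
  move=> s0 Dz.
  have dhz := dh _ _ s0 Dz.
  have dsq := is_derive1_sqrt s0.
  have d1 : is_derive s 1 (fun s : R => m * s + Num.sqrt s * z)
      (m + (2 * Num.sqrt s)^-1 * z).
    have -> : (fun s : R => m * s + Num.sqrt s * z) = m \*: id + z \*: Num.sqrt.
      by apply/funext => x; rewrite !fctE /= /GRing.scale/= (mulrC z).
    by apply: is_derive_eq; rewrite /GRing.scale/= !mulr1 (mulrC z).
  have d2 : is_derive s 1 (phi z \*: (h \o (fun s : R => m * s + Num.sqrt s * z)))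
     (phi z *: (k (m * s + Num.sqrt s * z) * (m + (2 * Num.sqrt s)^-1 * z))).
    apply: is_deriveZ.
  rewrite (_ : f^~ z = phi z \*: (h \o (fun s : R => m * s + Num.sqrt s * z))).
    by apply: is_derive_eq; rewrite /df /GRing.scale/= mulrC.
  by apply/funext => x; rewrite /f /GRing.scale/= mulrC.
(* The factor [(2 * Num.sqrt s)^-1] blows up at [0], so [s] is kept above [t / 2], where the factor
   is at most its value at [t / 2]; this makes [G] a dominating function independent of [s]. *)
pose G (z : R) := C * ((`|m| + (2 * Num.sqrt (t / 2))^-1 * `|z|) * phi z).
have t2 : 0 < t / 2 by rewrite divr_gt0.
have It : t \in (`]t / 2, t + 1[%classic : set R).
  by rewrite inE/= in_itv/=; apply/andP; split; lra.
have I0 (s : R) : `]t / 2, t + 1[%classic s -> 0 < s.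
  by rewrite /= in_itv/= => /andP[+ _]; exact: lt_trans.
have intf (s : R) : `]t / 2, t + 1[%classic s -> leb.-integrable D (EFin \o f s).
  by move=> _; exact: (integrable_affine (C := C)).
have derf (s z : R) : `]t / 2, t + 1[%classic s -> D z -> derivable (f ^~ z) s 1.
  by move=> /I0 s0 Dz; have := dfE _ _ s0 Dz => -[].
have pE (s z : R) : `]t / 2, t + 1[%classic s -> D z -> partial1of2 f s z = df s z.
  by move=> /I0 s0 Dz; rewrite partial1of2E; have := dfE _ _ s0 Dz => -[].
have G0 z : 0 <= G z.
  by rewrite /G !mulr_ge0 ?normal_pdf_ge0// addr_ge0// mulr_ge0// invr_ge0 mulr_ge0.
have iG : leb.-integrable D (EFin \o G).
  rewrite (_ : EFin \o G = (fun z => C%:E * ((`|m|%:E * (EFin \o phi) z) +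
     ((2 * Num.sqrt (t / 2))^-1)%:E *
       (EFin \o (Num.norm \o (fun z => z * phi z)%R)) z)))%E; last first.
    apply/funext => z; rewrite /G/= normrM (ger0_norm (normal_pdf_ge0 _ _ _)).
    by rewrite -!EFinM mulrDl mulrA.
  apply: integrableZl => //; apply: integrableD => //; apply: integrableZl => //.
    exact: integrable_phi.
  by apply: integrable_norm; exact: integrable_id_normal_pdf01.
have GP (s z : R) : `]t / 2, t + 1[%classic s -> D z -> `|partial1of2 f s z| <= G z.
  move=> Is Dz; rewrite pE// /df /G -mulrA normrM ler_pM// normrM.
  rewrite (ger0_norm (normal_pdf_ge0 _ _ _)) ler_wpM2r ?normal_pdf_ge0//.
  rewrite (le_trans (ler_normD _ _))// lerD2l normrM ler_wpM2r//.
  rewrite ger0_norm ?invr_ge0 ?mulr_ge0//.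
  rewrite lef_pV2 ?posrE ?mulr_gt0 ?sqrtr_gt0 ?(I0 _ Is)//.
  rewrite ler_pM2l// ler_wsqrtr//.
  by move: Is; rewrite /= in_itv/= => /andP[/ltW].
move: It; rewrite inE => It.
have dd := @derivable_under_integral R _ _ leb f D mD t (t / 2) (t + 1) It
  intf derf G G0 iG GP.
apply: DeriveDef => //.
rewrite -derive1E (@differentiation_under_integral R _ _ leb f D mD t (t / 2) (t + 1) It
  intf derf G G0 iG GP).
have i1 : leb.-integrable D (EFin \o (fun z => k (m * t + Num.sqrt t * z) * phi z)).
  exact: (integrable_affine (C := C)).
have i2 : leb.-integrable D
    (EFin \o (fun z => k (m * t + Num.sqrt t * z) * (z * phi z))).
  exact: (integrable_affine_id (C := C)).
rewrite -RintegralZl// -RintegralZl// -RintegralD//.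
- apply: eq_Rintegral => z; rewrite inE => Dz; rewrite pE// /df; ring.
- exact: (integrableZl _ m i1).
- exact: (integrableZl _ (2 * Num.sqrt t)^-1 i2).
Qed.

End gaussian_averages.

(** * The heat semigroup with drift on test functions *)

Section smooth_functions.
Context {R : realType}.
Implicit Types (f g h : R -> R).

(** Test functions, with compact support expressed as vanishing outside a ball: in this form the
    condition passes directly to derivatives and linear combinations. *)
Definition smooth_cs h : Prop :=
  (forall n (x : R), derivable (derive1n n h) x 1) /\
  exists M, forall x, M < `|x| -> h x = 0.

Lemma test_function_smooth_cs h : test_function h -> smooth_cs h.
Proof.
case=> dh /compact_bounded [M [_ hM]]; split => //.
exists (`|M| + 1) => x xM; apply/eqP; apply: contraTT xM => hx.
rewrite -leNgt; apply: hM; first by rewrite ltr_pwDr// ler_norm.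
exact: subset_closure.
Qed.

Lemma smooth_cs_derivable h (x : R) : smooth_cs h -> derivable h x 1.
Proof. by case=> /(_ 0%N x). Qed.

Lemma smooth_cs_is_derive h (x : R) : smooth_cs h -> is_derive x 1 h (derive1 h x).
Proof.
by move=> sh; apply: DeriveDef; [exact: smooth_cs_derivable|rewrite derive1E].
Qed.

Lemma smooth_cs_continuous h : smooth_cs h -> continuous h.
Proof.
by move=> sh x; apply/differentiable_continuous/derivable1_diffP/smooth_cs_derivable.
Qed.

Lemma smooth_cs_bounded h : smooth_cs h -> exists C, forall x, `|h x| <= C.
Proof.
move=> sh; have [_ [M hM]] := sh.
have := @continuous_compact _ _ h `[- M, M].
move=> /(_ _ (@segment_compact _ _ _)) /compact_bounded[].
  exact/continuous_subspaceT/smooth_cs_continuous.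
move=> C [_ hC]; exists (`|C| + 1) => x.
have [xM|/hM ->] := leP `|x| M; last by rewrite normr0 addr_ge0.
apply: hC; first by rewrite ltr_pwDr// ler_norm.
by exists x => //=; rewrite in_itv/= -ler_norml.
Qed.

Lemma derive1nSr n h : derive1n n (derive1 h) = derive1n n.+1 h.
Proof. by rewrite /derive1n -iterSr. Qed.

Lemma smooth_cs_derive1 h : smooth_cs h -> smooth_cs (derive1 h).
Proof.
move=> [dh [M hM]]; split => [n x|]; first by rewrite derive1nSr.
(* The condition [M < |x|] is open, so [h] coincides with the zero function near [x]. *)
exists M => x Mx; rewrite derive1E -(derive_cst (0 : R) x 1).
apply: near_eq_derive; near=> y; apply: hM.
by near: y; apply: (@cvgr_gt _ _ _ _ (fun y : R => `|y|)) Mx; exact: cvg_norm.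
Unshelve. all: by end_near. Qed.

Lemma derive1n_lin a b f g n : smooth_cs f -> smooth_cs g ->
  derive1n n (a \*: f + b \*: g) = a \*: derive1n n f + b \*: derive1n n g.
Proof.
move=> [df _] [dg _]; elim: n => // n ih.
rewrite !derive1nS ih; apply/funext => x; rewrite derive1E.
have da := derivableZ (k := a) (df n x); have db := derivableZ (k := b) (dg n x).
by rewrite (deriveD da db) (deriveZ _ (df n x)) (deriveZ _ (dg n x)) -!derive1E.
Qed.

Lemma smooth_cs_lin a b f g : smooth_cs f -> smooth_cs g ->
  smooth_cs (a \*: f + b \*: g).
Proof.
move=> sf sg; split => [n x|].
  rewrite (derive1n_lin _ _ _ sf sg); have [df _] := sf; have [dg _] := sg.
  exact: derivableD (derivableZ (df n x)) (derivableZ (dg n x)).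
have [_ [M hM]] := sf; have [_ [N hN]] := sg.
exists (Num.max M N) => x; rewrite gt_max => /andP[Mx Nx].
by rewrite !fctE /= hM// hN// !scaler0 addr0.
Qed.

(* The formal adjoint of [drift_op m], acting on test functions. *)
Definition drift_generator (m : R) h : R -> R :=
  2^-1 \*: derive1 (derive1 h) + m \*: derive1 h.

Lemma smooth_cs_drift_generator m h :
  smooth_cs h -> smooth_cs (drift_generator m h).
Proof.
move=> /smooth_cs_derive1 sh; exact: smooth_cs_lin (smooth_cs_derive1 sh) sh.
Qed.

Lemma derive1_drift_generator m h : smooth_cs h ->
  derive1 (drift_generator m h) = drift_generator m (derive1 h).
Proof.
move=> /smooth_cs_derive1 sh.
by rewrite -derive1n1 (derive1n_lin _ _ 1 (smooth_cs_derive1 sh) sh).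
Qed.

End smooth_functions.

(** Reflecting the negative half line. This is what relates the factor [2] and the half line in
    [p_I] to integrals over a centered normal variable. *)
Lemma ge0_even_integral (R : realType) (f : R -> \bar R) :
  measurable_fun [set: R] f -> (forall x, 0 <= f x)%E -> (forall x, f (- x) = f x) ->
  (\int[@lebesgue_measure R]_x f x =
   2%:E * \int[@lebesgue_measure R]_(x in `]0%R, +oo[) f x)%E.
Proof.
move=> mf f0 fN.
rewrite integral_itv_obnd_cbnd; last exact: measurable_funTS.
rewrite mule_natl mule2n [X in (_ = X + _)%E]ge0_integration_by_substitution0//.
under [X in (_ = X + _)%E]eq_integral do rewrite fN.
rewrite -(@integral_itv_bndo_bndc _ -oo%O); last exact: measurable_funTS.
rewrite -ge0_integral_setU//=; last 2 first.
- exact: measurable_funTS.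
- apply/disj_setPS => x /= [].
  by rewrite !in_itv/= andbT => x0; rewrite leNgt x0.
congr (integral _ _ _); apply/seteqP; split => // x _ /=.
by rewrite !in_itv/= andbT; have [|] := ltP x 0; [left|right].
Qed.

Lemma Rintegral_phi_half (R : realType) :
  2 * \int[@lebesgue_measure R]_(z in `]0, +oo[) normal_pdf (0 : R) 1 z = 1.
Proof.
have := integral_normal_pdf (0 : R) 1.
rewrite ge0_even_integral; first last.
- by move=> x; rewrite !normal_pdf01E sqrrN.
- by move=> x; rewrite lee_fin normal_pdf_ge0.
- by apply/measurable_EFinP; exact: measurable_normal_pdf.
have i1 : (@lebesgue_measure R).-integrable `]0, +oo[ (EFin \o normal_pdf (0 : R) 1).
  exact: integrable_phi.
rewrite -(fineK (integrable_fin_num _ i1))// -EFinM => -[].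
by rewrite /Rintegral.
Qed.

(** * The semigroup of Brownian motion with drift, and its average over the random time *)

Section heat_semigroup.
Context {R : realType}.
Local Notation leb := (@lebesgue_measure R).
Local Notation phi := (normal_pdf (0 : R) 1).
Variable m : R.
Implicit Types h f g : R -> R.

(** The expectation of [h] at a normal variable of mean [m * s] and variance [s]. In standardized
    form [s] enters through the argument of [h], and the Gaussian weight, singular at [s = 0]
    otherwise, stays fixed. *)
Definition heat h (s : R) : R :=
  \int[leb]_z (h (m * s + Num.sqrt s * z) * phi z).

Lemma heat_lin a b f g s : smooth_cs f -> smooth_cs g ->
  heat (a \*: f + b \*: g) s = a * heat f s + b * heat g s.
Proof.
move=> sf sg; have [C fC] := smooth_cs_bounded sf.
have [D gD] := smooth_cs_bounded sg.
have i1 := integrable_affine (m * s) (Num.sqrt s) (@measurableT _ _)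
  (smooth_cs_continuous sf) fC.
have i2 := integrable_affine (m * s) (Num.sqrt s) (@measurableT _ _)
  (smooth_cs_continuous sg) gD.
rewrite /heat -RintegralZl// -RintegralZl// -RintegralD//.
- apply: eq_Rintegral => z _; rewrite !fctE /= /GRing.scale/=; ring.
- exact: (integrableZl _ a i1).
- exact: (integrableZl _ b i2).
Qed.

Lemma heat_continuous h : smooth_cs h -> continuous (heat h).
Proof.
move=> sh; have [C hC] := smooth_cs_bounded sh.
apply: (continuous_gauss (C := C) (b := fun s => m * s) (sg := Num.sqrt)) => //.
- exact: smooth_cs_continuous.
- exact: mulrl_continuous.
- exact: sqrt_continuous.
Qed.

Lemma Rintegral_phi : \int[leb]_z phi z = 1.
Proof. by rewrite /Rintegral integral_normal_pdf. Qed.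

Lemma heat0 h : smooth_cs h -> heat h 0 = h 0.
Proof.
move=> sh; rewrite /heat mulr0 sqrtr0.
under eq_Rintegral do rewrite mul0r addr0.
by rewrite RintegralZl ?Rintegral_phi ?mulr1//; exact: integrable_phi.
Qed.

Lemma heat_le h C s : smooth_cs h -> (forall x, `|h x| <= C) -> `|heat h s| <= C.
Proof.
move=> sh hC.
have ih := integrable_affine (m * s) (Num.sqrt s) (@measurableT _ _)
  (smooth_cs_continuous sh) hC.
rewrite (le_trans (le_normr_Rintegral _ ih))//.
have -> : C = \int[leb]_z (C * phi z).
  by rewrite RintegralZl ?Rintegral_phi ?mulr1//; exact: integrable_phi.
apply: le_Rintegral => //.
- exact: (integrable_norm ih).
- by apply: (integrableZl _ C (integrable_phi _)).
- move=> z _; rewrite normrM (ger0_norm (normal_pdf_ge0 _ _ _)).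
  by rewrite ler_wpM2r// normal_pdf_ge0.
Qed.

(** Stein's identity on the whole line, deduced from the half-line version: with [a] chosen so that
    [h] and its derivative vanish at all [c + s * z] with [z <= a], both integrals live on []a,
    +oo[] and the boundary term is zero. *)
Lemma gauss_by_partsT h c s : smooth_cs h -> 0 < s ->
  \int[leb]_z (h (c + s * z) * (z * phi z)) =
  s * \int[leb]_z (derive1 h (c + s * z) * phi z).
Proof.
move=> sh s0; have sh' := smooth_cs_derive1 sh.
have [_ [M hM]] := sh; have [_ [M' hM']] := sh'.
have [C hC] := smooth_cs_bounded sh; have [C' hC'] := smooth_cs_bounded sh'.
(* For [z <= a] one has [c + s * z <= - N]. The [0] in the maximum makes [N] positive, so that
   [N <= |c + s * z|], and the [+ 1] puts this beyond both [M] and [M'] strictly. *)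
pose N := Num.max (Num.max M M') 0 + 1; pose a := - (N + c) / s.
have za z : z <= a -> h (c + s * z) = 0 /\ derive1 h (c + s * z) = 0.
  rewrite /a ler_pdivlMr// => za.
  have Nz : N <= `|c + s * z|.
    have N0 : 0 < N by rewrite /N ltr_wpDl// le_max lexx orbT.
    by clearbody N; rewrite ler0_norm; lra.
  by split; [apply: hM|apply: hM']; apply: (lt_le_trans _ Nz);
    rewrite /N ltr_pwDr// !le_max lexx ?orbT.
have sub (f : R -> R) : (forall z, z <= a -> f z = 0) ->
    \int[leb]_z f z = \int[leb]_(z in `]a, +oo[) f z.
  move=> fa; rewrite [RHS]Rintegral_mkcond; apply: eq_Rintegral => z _.
  rewrite patchE; case: ifPn => //; rewrite notin_setE/= in_itv/= andbT.
  by move/negP; rewrite -leNgt => /fa.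
rewrite sub; last by move=> z /za[-> _]; rewrite mul0r.
rewrite [in RHS]sub; last by move=> z /za[_ ->]; rewrite mul0r.
apply: etrans.
  apply: (@gauss_by_parts R h (derive1 h) (Num.max C C') a c s).
  - exact: smooth_cs_continuous.
  - exact: smooth_cs_continuous.
  - by move=> x; rewrite le_max hC.
  - by move=> x; rewrite le_max hC' orbT.
  - by move=> z _; exact: smooth_cs_is_derive.
by have [-> _] := za _ (lexx a); rewrite mul0r add0r.
Qed.

(** Differentiating [Num.sqrt s * z] leaves the weight [z / (2 * Num.sqrt s)] on [h']. Stein's
    identity turns it into [Num.sqrt s / (2 * Num.sqrt s) = 1 / 2] on [h''], and the drift
    contributes [m] times [h']. *)
Lemma is_derive_heat h (s : R) : smooth_cs h -> 0 < s ->
  is_derive s 1 (heat h) (heat (drift_generator m h) s).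
Proof.
move=> sh s0; have sh' := smooth_cs_derive1 sh.
have [C hC] := smooth_cs_bounded sh; have [C' hC'] := smooth_cs_bounded sh'.
apply: is_derive_eq.
  apply: (@is_derive_gauss R h (derive1 h) (Num.max C C') m s) => //.
  - exact: smooth_cs_continuous.
  - exact: smooth_cs_continuous.
  - by move=> x; rewrite le_max hC.
  - by move=> x; rewrite le_max hC' orbT.
  - by move=> u z _ _; exact: smooth_cs_is_derive.
rewrite gauss_by_partsT ?sqrtr_gt0// heat_lin//; last exact: smooth_cs_derive1.
rewrite -/(heat (derive1 h) s) -/(heat (derive1 (derive1 h)) s).
set A := heat _ _; set B := heat _ _.
have v0 : Num.sqrt s != 0 by rewrite gt_eqF// sqrtr_gt0.
by field.
Qed.

(* The expectation of [heat h] at the absolute value of a centered normal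
   variable of variance [t]. *)
Definition heat_avg h (t : R) : R :=
  2 * \int[leb]_(z in `]0, +oo[) (heat h (Num.sqrt t * z) * phi z).

(** The vacuous term [0 * t] brings the average into the shape of the Gaussian lemmas above, with
    drift [0]. *)
Lemma heat_avgE h t : heat_avg h t =
  2 * \int[leb]_(z in `]0, +oo[) (heat h (0 * t + Num.sqrt t * z) * phi z).
Proof. by rewrite mul0r; under [in RHS]eq_Rintegral do rewrite add0r. Qed.

Lemma heat_avg_lin a b f g t : smooth_cs f -> smooth_cs g ->
  heat_avg (a \*: f + b \*: g) t = a * heat_avg f t + b * heat_avg g t.
Proof.
move=> sf sg; have [C fC] := smooth_cs_bounded sf.
have [D gD] := smooth_cs_bounded sg.
have i1 := @integrable_affine R _ C (0 * t) (Num.sqrt t) `]0, +oo[ (measurable_itv _)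
  (heat_continuous sf) (fun s => heat_le s sf fC).
have i2 := @integrable_affine R _ D (0 * t) (Num.sqrt t) `]0, +oo[ (measurable_itv _)
  (heat_continuous sg) (fun s => heat_le s sg gD).
rewrite !heat_avgE mulrCA [b * _]mulrCA -mulrDr; congr (2 * _).
rewrite -RintegralZl// -RintegralZl// -RintegralD//.
- apply: eq_Rintegral => z _; rewrite heat_lin//; ring.
- exact: (integrableZl _ a i1).
- exact: (integrableZl _ b i2).
Qed.

Lemma heat_avg_continuous h : smooth_cs h -> continuous (heat_avg h).
Proof.
move=> sh; have [C hC] := smooth_cs_bounded sh.
rewrite (funext (heat_avgE h)) => t; apply: cvgM; first exact: cvg_cst.
apply: (continuous_gauss (C := C) (b := fun t => 0 * t) (sg := Num.sqrt)) => //.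
- exact: heat_continuous.
- by move=> s; exact: heat_le.
- exact: mulrl_continuous.
- exact: sqrt_continuous.
Qed.

Lemma heat_avg0 h : smooth_cs h -> heat_avg h 0 = h 0.
Proof.
move=> sh; rewrite /heat_avg sqrtr0.
under eq_Rintegral do rewrite mul0r heat0//.
rewrite RintegralZl//; last exact: integrable_phi.
by rewrite mulrCA Rintegral_phi_half mulr1.
Qed.

(** Write [L] for [drift_generator m]. Differentiation leaves the half-line integral of [heat (L h)]
    against [z * phi z]. Integrating by parts produces the term in [L (L h)] and, at [z = 0], the
    boundary value [L h 0 * phi 0] with [phi 0 = (Num.sqrt (2 * pi))^-1]. *)
Lemma is_derive_heat_avg h (t : R) : smooth_cs h -> 0 < t ->
  is_derive t 1 (heat_avg h)
   (2^-1 * heat_avg (drift_generator m (drift_generator m h)) t +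
    (Num.sqrt (2 * pi * t))^-1 * drift_generator m h 0).
Proof.
move=> sh t0; have st0 : 0 < Num.sqrt t by rewrite sqrtr_gt0.
have sL := smooth_cs_drift_generator m sh.
have sLL := smooth_cs_drift_generator m sL.
have [C hC] := smooth_cs_bounded sh; have [C1 hC1] := smooth_cs_bounded sL.
have [C2 hC2] := smooth_cs_bounded sLL.
have hM x : `|heat h x| <= Num.max C C1.
  by apply: heat_le => // y; rewrite le_max hC.
have hM1 x : `|heat (drift_generator m h) x| <= Num.max C C1.
  by apply: heat_le => // y; rewrite le_max hC1 orbT.
have dh (s z : R) : 0 < s -> `]0, +oo[%classic z ->
    is_derive (0 * s + Num.sqrt s * z) 1 (heat h)
      (heat (drift_generator m h) (0 * s + Num.sqrt s * z)).
  move=> s0; rewrite /= in_itv/= andbT => z0; apply: is_derive_heat => //.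
  by rewrite mul0r add0r mulr_gt0// sqrtr_gt0.
have dG := @is_derive_gauss R (heat h) (heat (drift_generator m h)) _ 0 t `]0, +oo[
  (measurable_itv _) t0 (heat_continuous sh) (heat_continuous sL) hM hM1 dh.
have := is_deriveZ 2 dG.
rewrite (_ : 2 \*: _ = heat_avg h); last first.
  by apply/funext => s; rewrite heat_avgE.
move/is_derive_eq; apply.
set J := \int[leb]_(z in _) (_ * (z * _)).
have -> : J = drift_generator m h 0 * phi 0 + Num.sqrt t *
    \int[leb]_(z in `]0, +oo[)
      (heat (drift_generator m (drift_generator m h)) (0 * t + Num.sqrt t * z) * phi z).
  apply: etrans.
    apply: (@gauss_by_parts R (heat (drift_generator m h))
      (heat (drift_generator m (drift_generator m h))) (Num.max C1 C2)).
    - exact: heat_continuous.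
    - exact: heat_continuous.
    - by move=> x; apply: heat_le => // y; rewrite le_max hC1.
    - by move=> x; apply: heat_le => // y; rewrite le_max hC2 orbT.
    - move=> z z0; apply: is_derive_heat => //.
      by rewrite mul0r add0r mulr_gt0.
  by rewrite mulr0 mul0r addr0 heat0.
rewrite mul0r add0r heat_avgE /GRing.scale/=.
have -> : phi 0 = (Num.sqrt (2 * pi))^-1.
  rewrite normal_pdf01E expr0n/= mul0r oppr0 expR0 mulr1 /normal_peak.
  by rewrite expr1n mul1r mulr_natl.
rewrite (sqrtrM t) ?mulr_ge0 ?pi_ge0//.
set u := Num.sqrt (2 * pi); set I := \int[leb]_(_ in _) _.
have u0 : u != 0 by rewrite gt_eqF// sqrtr_gt0 mulr_gt0// pi_gt0.
have v0 : Num.sqrt t != 0 by rewrite gt_eqF.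
by field; rewrite u0 v0.
Qed.

End heat_semigroup.

(** * The density as a mixture of normal densities *)

(** Used where [y] gives a variance [|y|]: at [y = 0] the normal law degenerates and formulas hold
    only by convention or not at all. Measurability of [g] off [0] is inherited from [f]. *)
Lemma eq_integral_neq0 (R : realType) (f g : R -> \bar R) :
  measurable_fun [set: R] f -> (forall y, y != 0 -> f y = g y) ->
  (\int[@lebesgue_measure R]_y f y = \int[@lebesgue_measure R]_y g y)%E.
Proof.
move=> mf fg; have mD : measurable ([set: R] `\ 0) by exact: measurableD.
have mf0 : measurable_fun ([set: R] `\ 0) f by exact: measurable_funTS.
have fg0 : {in [set: R] `\ 0, f =1 g}.
  by move=> y; rewrite inE => -[_ /eqP y0]; exact: fg.
have mg0 : measurable_fun ([set: R] `\ 0) g by exact: eq_measurable_fun fg0 mf0.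
rewrite -(@integral_setD1 _ _ 0 setT mD mf0) -(@integral_setD1 _ _ 0 setT mD mg0).
exact: eq_integral.
Qed.

Section gauss_substitution.
Context {R : realType}.
Local Notation leb := (@lebesgue_measure R).
Local Notation phi := (normal_pdf (0 : R) 1).

Lemma normal_pdf_affine (c s z : R) : 0 < s -> normal_pdf c s (c + s * z) * s = phi z.
Proof.
move=> s0; rewrite normal_pdf01E normal_pdfE ?gt_eqF//= /normal_fun addrAC subrr add0r.
rewrite mulrAC; congr (_ * expR _).
  rewrite /normal_peak expr1n mul1r -mulrnAr sqrtrM ?sqr_ge0// sqrtr_sqr gtr0_norm//.
  by rewrite invfM mulrAC mulVf ?mul1r// gt_eqF.
by rewrite -[_ *+ 2]mulr_natr exprMn; field; rewrite gt_eqF.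
Qed.

Lemma ge0_integral_normal_pdf (g : R -> R) (c s : R) : 0 < s -> continuous g ->
  (forall x, 0 <= g x) ->
  (\int[leb]_x (g x * normal_pdf c s x)%:E = \int[leb]_z (g (c + s * z) * phi z)%:E)%E.
Proof.
move=> s0 cg g0.
have cF : continuous (fun z : R => c + s * z) by exact: continuous_affine.
have dF := is_derive_affine c s.
have dFE : (fun z : R => c + s * z)^`()%classic = cst s.
  by apply/funext => z; rewrite derive1E; have [_ ->] := dF z.
rewrite (@increasing_ge0_integration_by_substitutionT _ (fun z : R => c + s * z)
  (fun x => g x * normal_pdf c s x)).
- by apply: eq_integral => z _; rewrite !fctE /= dFE -mulrA normal_pdf_affine.
- by move=> x y xy; rewrite ltrD2l ltr_pM2l.
- by rewrite dFE => z; exact: cvg_cst.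
- by rewrite dFE; exact: is_cvg_cst.
- by rewrite dFE; exact: is_cvg_cst.
- by move=> z; have [] := dF z.
- rewrite (_ : (fun z => c + s * z) = (fun z => z + c) \o (fun z => z * s)); last first.
    by apply/funext => z /=; rewrite addrC mulrC.
  apply: cvg_comp (cvg_addrr_Ny _).
  by apply: gt0_cvgMlNy => //; exact: cvg_id.
- rewrite (_ : (fun z => c + s * z) = (fun z => z + c) \o (fun z => z * s)); last first.
    by apply/funext => z /=; rewrite addrC mulrC.
  apply: cvg_comp (cvg_addrr _).
  by apply: gt0_cvgMly => //; exact: cvg_id.
- move=> x; apply: cvgM; first exact: cg.
  by apply: continuous_normal_pdf; rewrite gt_eqF.
- by move=> x; rewrite mulr_ge0// normal_pdf_ge0.
Qed.

End gauss_substitution.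

(** * The density [p_I] by Tonelli's theorem *)

Section iterated_density.
Context {R : realType}.
Local Notation leb := (@lebesgue_measure R).
Variables (m t : R).
Hypothesis t0 : 0 < t.
Local Notation w := (normal_pdf (0 : R) (Num.sqrt t)).

(* At [y = 0] this is [0] because [1 / 0 = 0]. *)
Definition drift_kernel (y x : R) : R :=
  expR (- ((x - m * `|y|) ^+ 2 / (2 * `|y|))) / Num.sqrt (2 * pi * `|y|).

Lemma drift_kernel_ge0 y x : 0 <= drift_kernel y x.
Proof. by rewrite divr_ge0 ?expR_ge0. Qed.

Lemma drift_kernelE y : y != 0 ->
  drift_kernel y = normal_pdf (m * `|y|) (Num.sqrt `|y|).
Proof.
move=> y0; apply/funext => x.
rewrite normal_pdfE ?gt_eqF ?sqrtr_gt0 ?normr_gt0//= /drift_kernel mulrC.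
rewrite /normal_peak /normal_fun sqr_sqrtr//; congr ((Num.sqrt _)^-1 * expR _).
  by rewrite -mulrnAr mulrC mulr_natl.
by rewrite mulr_natl mulNr.
Qed.

Lemma measurable_drift_kernel :
  measurable_fun setT (fun xy : R * R => drift_kernel xy.2 xy.1).
Proof.
have mabs : measurable_fun setT (fun xy : R * R => `|xy.2|).
  by apply: measurableT_comp => //; exact: measurable_snd.
(* Inversion is written as the power with exponent [-1], which agrees with it on nonnegative values,
   including [0]. *)
have minv (g : R * R -> R) : (forall x, 0 <= g x) -> measurable_fun setT g ->
    measurable_fun setT (fun x => (g x)^-1).
  move=> g0 mg; rewrite (_ : (fun x => _) = (fun x => g x `^ (-1))).
    exact: (measurableT_comp (measurable_powR _)).
  by apply/funext => x; rewrite powR_inv1.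
apply: measurable_funM.
  apply: measurableT_comp => //; apply: measurableT_comp => //.
  apply: measurable_funM.
    apply: measurable_funX; apply: measurable_funB; first exact: measurable_fst.
    exact: measurable_funM.
  apply: minv; first by move=> xy; rewrite mulr_ge0.
  exact: measurable_funM.
apply: minv => //; apply: measurableT_comp; last exact: measurable_funM.
by apply: continuous_measurable_fun; exact: sqrt_continuous.
Qed.

(** Tonelli's theorem. The two inner integrands may differ at [y = 0], where [drift_kernel] vanishes
    while [normal_pdf] still has total mass [1]; a single point is negligible. *)
Lemma ge0_integral_drift_kernel (f : R -> R) : measurable_fun setT f ->
  (forall x, 0 <= f x) ->
  (\int[leb]_x \int[leb]_y (f x * (drift_kernel y x * w y))%:E =
   \int[leb]_y ((w y)%:E *
     \int[leb]_x (f x * normal_pdf (m * `|y|) (Num.sqrt `|y|) x)%:E))%E.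
Proof.
move=> mf f0.
pose F (xy : R * R) := ((f xy.1 * (drift_kernel xy.2 xy.1 * w xy.2))%:E)%E.
have mF : measurable_fun setT F.
  apply/measurable_EFinP; apply: measurable_funM.
    exact: (measurableT_comp mf measurable_fst).
  apply: measurable_funM; first exact: measurable_drift_kernel.
  exact: (measurableT_comp (measurable_normal_pdf _ _) measurable_snd).
have F0 xy : (0 <= F xy)%E.
  by rewrite lee_fin !mulr_ge0 ?f0 ?drift_kernel_ge0 ?normal_pdf_ge0.
rewrite (@fubini_tonelli _ _ _ _ _ leb leb F mF F0).
have mG := @measurable_fun_fubini_tonelli_G _ _ _ _ _ leb F mF F0.
pose H y := ((w y)%:E *
  \int[leb]_x (f x * normal_pdf (m * `|y|) (Num.sqrt `|y|) x)%:E)%E.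
have GH y : y != 0 -> (\int[leb]_x F (x, y) = H y)%E.
  move=> y0; have mfk : measurable_fun [set: R]
      (fun x => (f x * normal_pdf (m * `|y|) (Num.sqrt `|y|) x)%:E).
    by apply/measurable_EFinP/measurable_funM => //; exact: measurable_normal_pdf.
  rewrite /H; apply: etrans; last apply: (ge0_integralZl leb measurableT mfk).
  - apply: eq_integral => x _; rewrite /F /= drift_kernelE// -EFinM; congr EFin; ring.
  - by move=> x _; rewrite lee_fin mulr_ge0 ?f0 ?normal_pdf_ge0.
  - by rewrite lee_fin normal_pdf_ge0.
exact: eq_integral_neq0 mG GH.
Qed.

(** The extended-real form of the density, on which Tonelli's theorem operates. Its total mass [1]
    yields finiteness for almost every [x]. *)
Let pE (x : R) := (\int[leb]_y (drift_kernel y x * w y)%:E)%E.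

Let pE_ge0 x : (0 <= pE x)%E.
Proof.
by apply: integral_ge0 => y _; rewrite lee_fin mulr_ge0 ?drift_kernel_ge0 ?normal_pdf_ge0.
Qed.

Let measurable_pE : measurable_fun [set: R] pE.
Proof.
pose F (xy : R * R) := ((drift_kernel xy.2 xy.1 * w xy.2)%:E)%E.
apply: (@measurable_fun_fubini_tonelli_F _ _ _ _ _ leb F).
  apply/measurable_EFinP; apply: measurable_funM; first exact: measurable_drift_kernel.
  exact: (measurableT_comp (measurable_normal_pdf _ _) measurable_snd).
by move=> xy; rewrite lee_fin mulr_ge0 ?drift_kernel_ge0 ?normal_pdf_ge0.
Qed.

Let integral_pE : (\int[leb]_x pE x = 1)%E.
Proof.
have := @ge0_integral_drift_kernel (cst 1) (measurable_cst _) (fun _ => ler01).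
under eq_integral do under eq_integral do rewrite mul1r.
move=> ->; rewrite -(integral_normal_pdf 0 (Num.sqrt t)); apply: eq_integral => y _.
under eq_integral do rewrite mul1r.
by rewrite integral_normal_pdf mule1.
Qed.

Lemma p_IE x : p_I m x t = fine (pE x).
Proof.
rewrite /pE ge0_even_integral.
- rewrite /p_I /Rintegral.
  rewrite (_ : \int[leb]_(y in `]0%R, +oo[) _ = \int[leb]_(y in `]0%R, +oo[)
    (drift_kernel y x * w y)%:E)%E; last first.
    apply: eq_integral => y; rewrite inE/= in_itv/= andbT => y0.
    rewrite /drift_kernel gtr0_norm//; congr (_ * _)%:E.
    rewrite normal_pdfE ?gt_eqF ?sqrtr_gt0//= /normal_peak /normal_fun subr0.
    rewrite sqr_sqrtr ?ltW// mulrC mulNr; congr ((Num.sqrt _)^-1 * expR (- (_ / _))).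
      by rewrite -mulrnAr mulrC mulr_natl.
    by rewrite mulr_natl.
  have : (0 <= \int[leb]_(y in `]0%R, +oo[) (drift_kernel y x * w y)%:E)%E.
    apply: integral_ge0 => y _.
    by rewrite lee_fin mulr_ge0 ?drift_kernel_ge0 ?normal_pdf_ge0.
  (* If the half-line integral were [+oo], both sides would be [0], because [fine] sends [+oo] to
     [0]. *)
  case: (\int[leb]_(y in _) _)%E => [r|_|//] //=.
  by rewrite mulry gtr0_sg// mul1e mulr0.
- apply/measurable_EFinP; apply: measurable_funM.
    exact: (measurableT_comp measurable_drift_kernel (pair1_measurable x)).
  exact: measurable_normal_pdf.
- by move=> y; rewrite lee_fin mulr_ge0 ?drift_kernel_ge0 ?normal_pdf_ge0.
- move=> y; rewrite /drift_kernel normrN; congr (_ * _)%:E.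
  rewrite !normal_pdfE ?gt_eqF ?sqrtr_gt0//= /normal_fun.
  by rewrite !subr0 sqrrN.
Qed.

Lemma p_I_ge0 x : 0 <= p_I m x t.
Proof. by rewrite p_IE fine_ge0. Qed.

Lemma measurable_p_I : measurable_fun [set: R] (fun x => p_I m x t).
Proof.
rewrite (_ : (fun x => _) = fine \o pE); last by apply/funext => x; rewrite p_IE.
by apply: measurableT_comp measurable_pE => //.
Qed.

(** [p_I] is the mixture of the normal laws of mean [m * |y|] and variance [|y|] over a centered
    normal [y] of variance [t]. The passage from [pE] to its real part [p_I] is an equality almost
    everywhere, as [pE] is integrable. *)
Lemma ge0_integral_p_I (f : R -> R) : measurable_fun [set: R] f ->
  (forall x, 0 <= f x) ->
  (\int[leb]_x (f x * p_I m x t)%:E =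
   \int[leb]_y ((w y)%:E *
     \int[leb]_x (f x * normal_pdf (m * `|y|) (Num.sqrt `|y|) x)%:E))%E.
Proof.
move=> mf f0; rewrite -ge0_integral_drift_kernel//.
have fpE x : (\int[leb]_y (f x * (drift_kernel y x * w y))%:E = (f x)%:E * pE x)%E.
  rewrite -ge0_integralZl//.
  - apply/measurable_EFinP; apply: measurable_funM.
      exact: (measurableT_comp measurable_drift_kernel (pair1_measurable x)).
    exact: measurable_normal_pdf.
  - by move=> y _; rewrite lee_fin mulr_ge0 ?drift_kernel_ge0 ?normal_pdf_ge0.
  - by rewrite lee_fin.
transitivity (\int[leb]_x ((f x)%:E * pE x))%E; last first.
  by apply: eq_integral => x _; rewrite fpE.
have ipE : leb.-integrable setT pE.
  apply/integrableP; split => //.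
  by under eq_integral do rewrite gee0_abs//; rewrite integral_pE ltry.
apply: ge0_ae_eq_integral => //.
- apply/measurable_EFinP; apply: measurable_funM => //; exact: measurable_p_I.
- by apply: emeasurable_funM => //; exact/measurable_EFinP.
- by move=> x _; rewrite lee_fin mulr_ge0// p_I_ge0.
- by move=> x _; rewrite mule_ge0// lee_fin.
- have := integrable_ae measurableT ipE.
  apply: filterS => x /(_ Logic.I) px _.
  by rewrite p_IE EFinM fineK.
Qed.

Lemma integral_p_I : (\int[leb]_x (p_I m x t)%:E = 1)%E.
Proof.
have := @ge0_integral_p_I (cst 1) (measurable_cst _) (fun _ => ler01).
under eq_integral do rewrite mul1r.
move=> ->; rewrite -(integral_normal_pdf 0 (Num.sqrt t)); apply: eq_integral => y _.
under eq_integral do rewrite mul1r.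
by rewrite integral_normal_pdf mule1.
Qed.

Lemma integrable_p_I : leb.-integrable setT (EFin \o (fun x => p_I m x t)).
Proof.
apply/integrableP; split; first by apply/measurable_EFinP; exact: measurable_p_I.
under eq_integral do rewrite /= ger0_norm ?p_I_ge0//.
by rewrite integral_p_I ltry.
Qed.

Lemma integral_p_I_set (A : set R) : measurable A ->
  (\int[leb]_(x in A) (p_I m x t)%:E =
   \int[leb]_y ((w y)%:E * normal_prob (m * `|y|) (Num.sqrt `|y|) A))%E.
Proof.
move=> mA.
have h (g : R -> R) : (\int[leb]_(x in A) (g x)%:E = \int[leb]_x (\1_A x * g x)%:E)%E.
  rewrite integral_mkcond; apply: eq_integral => x _.
  by rewrite patchE indicE; case: (x \in A); rewrite ?mul1r ?mul0r.
rewrite (h (fun x => p_I m x t)) (ge0_integral_p_I (f := \1_A))//.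
by apply: eq_integral => y _; rewrite /normal_prob h.
Qed.

End iterated_density.

(** * The pairing of the density with test functions *)

Section pairing.
Context {R : realType}.
Local Notation leb := (@lebesgue_measure R).
Local Notation phi := (normal_pdf (0 : R) 1).

Lemma integrable_linear (h : R -> R) (C s : R) (D : set R) : measurable D ->
  continuous h -> (forall x, `|h x| <= C) ->
  leb.-integrable D (EFin \o (fun z => h (s * z) * phi z)).
Proof.
move=> mD ch hC; rewrite (_ : (fun z => _) = (fun z => h (0 + s * z) * phi z)).
  exact: (integrable_affine (C := C)).
by apply/funext => z; rewrite add0r.
Qed.

Lemma heat_even_half (h : R -> R) (C s : R) : 0 <= s -> continuous h ->
  (forall x, 0 <= h x) -> (forall x, h x <= C) ->
  (\int[leb]_z (h `|s * z| * phi z)%:E =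
   (2 * \int[leb]_(z in `]0%R, +oo[) (h (s * z) * phi z))%:E)%E.
Proof.
move=> s0 ch h0 hC.
have cph : continuous phi by apply: continuous_normal_pdf; rewrite oner_eq0.
have i1 : leb.-integrable `]0, +oo[ (EFin \o (fun z => h (s * z) * phi z)).
  by apply: (integrable_linear (C := C)) => // x; rewrite ger0_norm.
rewrite ge0_even_integral.
- rewrite EFinM /Rintegral; congr (_ * _)%E.
  rewrite fineK; last first.
    exact: (integrable_fin_num (mu := leb) _ i1).
  apply: eq_integral => z; rewrite inE/= in_itv/= andbT => z0.
  by rewrite ger0_norm// mulr_ge0// ltW.
- apply/measurable_EFinP; apply: measurable_funM; last exact: measurable_normal_pdf.
  apply: continuous_measurable_fun => z; apply: continuous_comp; last exact: ch.
  by apply: continuous_comp; [exact: mulrl_continuous|exact: norm_continuous].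
- by move=> z; rewrite lee_fin mulr_ge0// normal_pdf_ge0.
- by move=> z; rewrite mulrN normrN !normal_pdf01E sqrrN.
Qed.

(** The mixture formula covers nonnegative functions only. It is applied to [h + C] with [C] a bound
    of [|h|], and the constant is subtracted at the end, both sides having total mass [1]. *)
Lemma regular_p_I (m t : R) (h : R -> R) : 0 < t -> smooth_cs h ->
  regular (fun x => p_I m x t) h = heat_avg m h t.
Proof.
move=> t0 sh; have [C hC] := smooth_cs_bounded sh.
have st0 : 0 < Num.sqrt t by rewrite sqrtr_gt0.
have ch := smooth_cs_continuous sh.
have C0 : 0 <= C by exact: le_trans (hC 0).
have hC0 x : 0 <= h x + C by have := hC x; rewrite ler_norml => /andP[]; lra.
have gC0 s : 0 <= heat m h s + C.
  by have := heat_le m s sh hC; rewrite ler_norml => /andP[]; lra.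
have ip := integrable_p_I m t0.
have ihp : leb.-integrable setT (EFin \o (fun x => p_I m x t * h x)).
  rewrite (_ : (fun x => _) = (fun x => h x * p_I m x t)); last first.
    by apply/funext => x; rewrite mulrC.
  apply: (integrable_boundedMr (M := C)) => //.
  exact: continuous_measurable_fun.
have mhC : measurable_fun [set: R] (fun x => h x + C).
  by apply: measurable_funD => //; exact: continuous_measurable_fun.
have := ge0_integral_p_I m t0 mhC hC0.
have -> : (\int[leb]_x ((h x + C) * p_I m x t)%:E =
    (regular (fun x => p_I m x t) h + C)%:E)%E.
  have -> : regular (fun x => p_I m x t) h + C =
      \int[leb]_x (p_I m x t * h x + C * p_I m x t).
    rewrite RintegralD//; last exact: (integrableZl _ C ip).
    rewrite RintegralZl//; congr (_ + _).
    by rewrite /Rintegral integral_p_I// mulr1.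
  rewrite /Rintegral fineK; last first.
    apply: (integrable_fin_num (mu := leb)) => //.
    by apply: (integrableD _ ihp (integrableZl _ C ip)).
  by apply: eq_integral => x _; congr EFin; ring.
have -> : (\int[leb]_y ((normal_pdf 0 (Num.sqrt t) y)%:E * \int[leb]_x
     ((h x + C) * normal_pdf (m * `|y|) (Num.sqrt `|y|) x)%:E) =
     \int[leb]_y ((heat m h `|y| + C) * normal_pdf 0 (Num.sqrt t) y)%:E)%E.
  apply/esym/eq_integral_neq0 => [|y y0].
    apply/measurable_EFinP; apply: measurable_funM; last exact: measurable_normal_pdf.
    apply: continuous_measurable_fun => y; apply: cvgD; last exact: cvg_cst.
    by apply: continuous_comp; [exact: norm_continuous|exact: heat_continuous].
  rewrite ge0_integral_normal_pdf ?sqrtr_gt0 ?normr_gt0//; last first.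
    by move=> x; apply: cvgD; [exact: ch|exact: cvg_cst].
  rewrite mulrC EFinM; congr (_ * _)%E.
  have i1 := integrable_affine (m * `|y|) (Num.sqrt `|y|) (@measurableT _ _) ch hC.
  have i2 : leb.-integrable setT (EFin \o (fun z => C * phi z)).
    by apply: (integrableZl _ C (integrable_phi _)).
  have -> : heat m h `|y| + C =
      \int[leb]_z (h (m * `|y| + Num.sqrt `|y| * z) * phi z + C * phi z).
    rewrite RintegralD// RintegralZl//; last exact: integrable_phi.
    by rewrite Rintegral_phi mulr1.
  rewrite /Rintegral fineK; last first.
    exact: (integrable_fin_num (mu := leb) _ (integrableD _ i1 i2)).
  by apply: eq_integral => z _; rewrite mulrDl.
rewrite ge0_integral_normal_pdf//; last first.
  move=> x; apply: cvgD; last exact: cvg_cst.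
  apply: continuous_comp; first exact: norm_continuous.
  exact: heat_continuous.
under eq_integral do rewrite add0r.
rewrite (heat_even_half (h := fun s => heat m h s + C) (C := C + C))//; first last.
- move=> s; rewrite lerD2r; apply: le_trans (ler_norm _) _; exact: heat_le.
- by move=> x; apply: cvgD; [exact: heat_continuous|exact: cvg_cst].
move=> [] /(canRL (addrK _)) ->.
have i1 := @integrable_linear _ C (Num.sqrt t) `]0, +oo[ (measurable_itv _)
  (heat_continuous sh) (fun s => heat_le m s sh hC).
have i2 : leb.-integrable `]0, +oo[ (EFin \o (fun z => C * phi z)).
  by apply: (integrableZl _ C (integrable_phi _)).
rewrite /heat_avg /=.
under eq_Rintegral do rewrite mulrDl.
rewrite RintegralD// RintegralZl//; last exact: integrable_phi.
by rewrite mulrDr [2 * (C * _)]mulrCA Rintegral_phi_half mulr1 addrK.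
Qed.

End pairing.

(** * The law of Brownian motion at an independent random time *)

Section probability_limits.
Context {R : realType} d {T : measurableType d} (P : probability T R).
Local Open Scope ereal_scope.

(** Dominated convergence for indicators, with the constant [1] as dominating function. *)
Lemma cvg_probability_sets (E_ : (set T)^nat) (E N : set T) :
  (forall n, measurable (E_ n)) -> measurable E -> measurable N -> P N = 0 ->
  (forall w, ~ N w -> \forall n \near \oo, E_ n w <-> E w) ->
  P (E_ n) @[n --> \oo] --> P E.
Proof.
move=> mE_ mE mN N0 E_E.
have PE (F : set T) : measurable F -> P F = \int[P]_w (\1_F w)%:E.
  by move=> mF; rewrite integral_indic// setIT.
rewrite PE// (funext (fun n => PE _ (mE_ n))).
have [] := @dominated_convergence _ _ _ P setT measurableT
  (fun n w => (\1_(E_ n) w)%:E) (fun w => (\1_E w)%:E) (cst 1) => //.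
- by move=> n; apply/measurable_EFinP; exact: measurable_indic.
- by apply/measurable_EFinP; exact: measurable_indic.
- exists N; split => // w /= h; apply: contrapT => nN; apply: h => _.
  apply: cvg_near_cst; near=> n.
  have : E_ n w <-> E w by near: n; exact: E_E.
  move=> h; have wE : (w \in E_ n) = (w \in E) by apply/idP/idP; rewrite !inE => /h.
  by rewrite !indicE wE.
- exact: finite_measure_integrable_cst.
- apply: aeW => w n _; rewrite lee_fin ger0_norm// indicE.
Unshelve. all: by end_near. Qed.

(** Open right rays are stable under intersection and generate the Borel sets, so the pushforward of
    [P] and the measure of density [p] coincide once they agree on them. The rays [g n] exhaust the
    line and have finite mass. *)
Lemma probability_eq_on_rays (Z : T -> R) (p : R -> R) :
  measurable_fun setT Z -> measurable_fun [set: R] p -> (forall x, (0 <= p x)%R) ->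
  (forall a, P (Z @^-1` `]a, +oo[%classic) =
    \int[lebesgue_measure]_(x in `]a, +oo[) (p x)%:E) ->
  forall A, measurable A -> P (Z @^-1` A) = \int[lebesgue_measure]_(x in A) (p x)%:E.
Proof.
move=> mZ mp p0 hray.
have mZpre (B : set R) : measurable B -> measurable (Z @^-1` B).
  by move=> mB; rewrite -[X in measurable X]setTI; exact: mZ.
pose nu (A : set R) := \int[@lebesgue_measure R]_(x in A) (p x)%:E.
have mp' : measurable_fun [set: R] (EFin \o p) by exact/measurable_EFinP.
have nu0 : nu set0 = 0 by rewrite /nu integral_set0.
have nu_ge0 A : 0 <= nu A by apply: integral_ge0 => x _; rewrite lee_fin.
have nus : semi_sigma_additive nu.
  move=> F mF tF mUF; rewrite /nu ge0_integral_bigcup//.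
  - apply: is_cvg_ereal_nneg_natsum_cond => n _ _; exact: nu_ge0.
  - exact: measurable_funTS.
  - by move=> x _; rewrite lee_fin.
pose nuM : {measure set R -> \bar R} :=
  HB.pack nu (isMeasure.Build _ _ _ nu nu0 nu_ge0 nus).
pose muM := measure_function_pushforward__canonical__measure_function_Measure P mZ.
pose g (n : nat) : set R := `](- n%:R)%R, +oo[%classic.
have nuE A : nu A = nuM A by [].
move=> A mA; rewrite -/(nu A) nuE.
apply: (@measure_unique _ R R (@RGenOInfty.G R) g _ _ _ _ muM nuM) => //.
- exact: RGenOInfty.measurableE.
- move=> B C [x ->] [y ->]; exists (Num.max x y).
  apply/seteqP; split => z /=; rewrite !in_itv/= !andbT gt_max.
    by case=> -> ->.
  by move/andP.
- by move=> n; exists (- n%:R)%R.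
- apply/seteqP; split => // x _; exists (Num.truncn (- x)).+1 => //.
  by rewrite /g/= in_itv/= andbT ltrNl truncnS_gt.
- by move=> B [x ->]; exact: hray.
- move=> n; have mg : measurable (Z @^-1` g n).
    by apply: mZpre; exact: measurable_itv.
  exact: le_lt_trans (probability_le1 P mg) (ltry 1).
Qed.

End probability_limits.

(** * Discretization of the random time *)

Section grid.
Context {R : realType}.

Definition grid (n : nat) (y : R) : nat := Num.truncn (n.+1%:R * `|y|).

(** The right endpoint of the cell: it is positive even for [k = 0], so [B1] has a nondegenerate
    normal law at this time. *)
Definition grid_time (n k : nat) : R := k.+1%:R / n.+1%:R.

Definition cell (n k : nat) : set R := [set y | grid n y = k].

Lemma grid_time_gt0 n k : 0 < grid_time n k.
Proof. by rewrite divr_gt0// ltr0n. Qed.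

Lemma measurable_cell n k : measurable (cell n k).
Proof.
rewrite (_ : cell n k = (fun y : R => n.+1%:R * `|y|) @^-1` `[k%:R, k.+1%:R[%classic).
  rewrite -[X in measurable X]setTI.
  have : measurable_fun [set: R] (fun y : R => n.+1%:R * `|y|).
    by apply: measurable_funM => //; exact: measurableT_comp.
  by apply => //; exact: measurable_itv.
apply/seteqP; split => y; rewrite /cell /grid /= in_itv/=.
  by move=> <-; apply: truncn_itv; rewrite mulr_ge0.
exact: truncn_def.
Qed.

Lemma bigcup_cell n : \bigcup_k cell n k = setT.
Proof. by apply/seteqP; split => // y _; exists (grid n y). Qed.

Lemma trivIset_cell n : trivIset setT (cell n).
Proof. by move=> i j _ _ [y [<- <-]]. Qed.

Lemma grid_time_cvg y : grid_time n (grid n y) @[n --> \oo] --> `|y|.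
Proof.
have h0 : `|y| + n.+1%:R^-1 @[n --> \oo] --> `|y| + 0.
  by apply: cvgD; [exact: cvg_cst|exact: cvg_harmonic].
rewrite addr0 in h0.
apply: (squeeze_cvgr _ (cvg_cst `|y|) h0).
apply: nearW => n; rewrite /grid_time /grid.
have /truncn_itv/andP[] : 0 <= n.+1%:R * `|y| by rewrite mulr_ge0.
set k := Num.truncn _ => k1 k2.
rewrite ler_pdivlMr ?ltr0n// mulrC ltW//=.
by rewrite ler_pdivrMr ?ltr0n// mulrDl mulVf ?pnatr_eq0// -natr1 lerD2r mulrC.
Qed.

(** The index takes countably many values and the map is [f k] on each cell, so no joint
    measurability in time and sample point enters. *)
Lemma measurable_fun_grid d d' (T : measurableType d) (U : measurableType d')
    (n : nat) (X : T -> R) (f : nat -> T -> U) :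
  measurable_fun setT X -> (forall k, measurable_fun setT (f k)) ->
  measurable_fun setT (fun w => f (grid n (X w)) w).
Proof.
move=> mX mf.
have -> : [set: T] = \bigcup_k (X @^-1` cell n k).
  by rewrite -preimage_bigcup bigcup_cell preimage_setT.
apply/measurable_fun_bigcup => k.
  by rewrite -[X in measurable X]setTI; apply: mX => //; exact: measurable_cell.
apply: (eq_measurable_fun (f k)); last exact: measurable_funTS.
by move=> w; rewrite inE /cell /= => ->.
Qed.

End grid.

Section subordinated_law.
Context {R : realType} d {T : measurableType d} (P : probability T R).

Lemma brownian_motion_law (m : R) (X : R -> T -> R) (t : R) (A : set R) :
  brownian_motion P m X -> 0 < t -> measurable A ->
  P (X t @^-1` A) = normal_prob (m * t) (Num.sqrt t) A.
Proof.
move=> [_ X0 _ _ /(_ 0 t (lexx 0))] h t0 mA; have := h t0 A mA.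
rewrite subr0 => <-; congr (P _).
by apply/seteqP; split => w /=; rewrite X0 subr0.
Qed.

Lemma brownian_path_cvg (m : R) (X : R -> T -> R) (u : nat -> R) (s : R) w :
  brownian_motion P m X -> 0 <= s -> (forall n, 0 <= u n) ->
  u n @[n --> \oo] --> s -> X (u n) w @[n --> \oo] --> X s w.
Proof.
move=> [_ _ + _ _] s0 u0 us => /(_ w) /subspace_continuousP.
have sI : `[0, +oo[%classic s by rewrite /= in_itv/= andbT.
move=> /(_ s sI); apply: cvg_comp => B [e /= e0 eB].
have := us; move=> /cvgrPdist_lt /(_ e e0); apply: filterS => n sun.
by apply: eB => //=; rewrite in_itv/= andbT.
Qed.

Variables (m : R) (B1 B2 : R -> T -> R).
Hypotheses (hB1 : brownian_motion P m B1) (hB2 : brownian_motion P 0 B2).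
Hypothesis hB12 : independent_processes P B1 B2.

Let measurable_B1 s : 0 <= s -> measurable_fun setT (B1 s).
Proof. by case: hB1 => + _ _ _ _; exact. Qed.

Let measurable_B2 s : 0 <= s -> measurable_fun setT (B2 s).
Proof. by case: hB2 => + _ _ _ _; exact. Qed.

Lemma independent_marginals (s t : R) (A B : set R) : 0 <= s -> 0 <= t ->
  measurable A -> measurable B ->
  P (B1 s @^-1` A `&` B2 t @^-1` B) = (P (B1 s @^-1` A) * P (B2 t @^-1` B))%E.
Proof.
move=> s0 t0 mA mB; apply: hB12; apply: sub_sigma_algebra.
  by exists s, A.
by exists t, B.
Qed.

(* The boundary of [A] is contained in [{a}]. *)
Definition off_boundary (A : set R) (a : R) : Prop :=
  forall x, x != a -> \forall y \near x, A y <-> A x.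

Lemma off_boundary_lt (a : R) : off_boundary `]-oo, a[ a.
Proof.
move=> x; rewrite neq_lt => /orP[xa|ax]; near=> y; rewrite /= !in_itv/=.
  have ya : y < a by near: y; exact: lt_nbhsl.
  by rewrite ya xa.
have ya : a < y by near: y; exact: lt_nbhsr.
by rewrite !ltNge !ltW.
Unshelve. all: by end_near. Qed.

Lemma off_boundary_gt (a : R) : off_boundary `]a, +oo[ a.
Proof.
move=> x; rewrite neq_lt => /orP[xa|ax]; near=> y; rewrite /= !in_itv/= !andbT.
  have ya : y < a by near: y; exact: lt_nbhsl.
  by rewrite !ltNge !ltW.
have ya : a < y by near: y; exact: lt_nbhsr.
by rewrite ya ax.
Unshelve. all: by end_near. Qed.

(** A fact about normal laws obtained from [B1]: by path continuity the events [B1 (u n) \in A]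
    converge to [B1 s \in A] off the event [B1 s = a], which is null because the law of [B1 s] has a
    density. *)
Lemma normal_prob_cvg (A : set R) (a : R) (u : nat -> R) (s : R) :
  measurable A -> off_boundary A a -> 0 < s -> (forall n, 0 < u n) ->
  u n @[n --> \oo] --> s ->
  normal_prob (m * u n) (Num.sqrt (u n)) A @[n --> \oo] -->
  normal_prob (m * s) (Num.sqrt s) A.
Proof.
move=> mA Aa s0 u0 us.
rewrite -(brownian_motion_law hB1 s0 mA).
rewrite -(funext (fun n => brownian_motion_law hB1 (u0 n) mA)).
have mpre v (B : set R) : 0 < v -> measurable B -> measurable (B1 v @^-1` B).
  move=> v0 mB; rewrite -[X in measurable X]setTI.
  by apply: measurable_B1 => //; exact: ltW.
apply: (@cvg_probability_sets _ _ _ _ _ _ (B1 s @^-1` [set a])).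
- by move=> n; exact: mpre.
- exact: mpre.
- exact: mpre.
- rewrite (brownian_motion_law hB1)// /normal_prob; exact: integral_set1.
- move=> w /= /eqP /Aa h.
  have hc : B1 (u n) w @[n --> \oo] --> B1 s w.
    apply: (brownian_path_cvg (w := w) hB1) => //; first exact: ltW.
    by move=> n; exact: ltW.
  exact: (hc _ h).
Qed.

Variable t : R.
Hypothesis t0 : 0 < t.
Local Notation w := (normal_pdf (0 : R) (Num.sqrt t)).
Local Notation leb := (@lebesgue_measure R).

Let Zn n (v : T) : R := B1 (grid_time n (grid n (B2 t v))) v.
Let Z (v : T) : R := B1 `|B2 t v| v.

Let measurable_Zn n : measurable_fun setT (Zn n).
Proof.
apply: (@measurable_fun_grid _ _ _ _ _ n (B2 t) (fun k => B1 (grid_time n k))).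
  exact: measurable_B2 (ltW t0).
by move=> k; apply: measurable_B1; exact: ltW (grid_time_gt0 _ _).
Qed.

Let cvg_Zn v : Zn n v @[n --> \oo] --> Z v.
Proof.
apply: (brownian_path_cvg (w := v) hB1) => //; last exact: grid_time_cvg.
by move=> n; exact: ltW (grid_time_gt0 _ _).
Qed.

Lemma measurable_subordinated : measurable_fun setT Z.
Proof. by apply: measurable_fun_cvg measurable_Zn _ => v _; exact: cvg_Zn. Qed.

Let G (A : set R) (s : R) := normal_prob (m * s) (Num.sqrt s) A.

Let mG n A : measurable_fun [set: R] (fun y => (w y)%:E * G A (grid_time n (grid n y)))%E.
Proof.
apply: emeasurable_funM; first by apply/measurable_EFinP; exact: measurable_normal_pdf.
exact: (@measurable_fun_grid _ _ _ _ _ n id (fun k _ => G A (grid_time n k))).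
Qed.

(** Where [|B2 t|] lies in the [k]-th cell, [Zn n] is [B1] at a deterministic time, so independence
    factors the probability. Summing over the cells reassembles the integral. *)
Lemma subordinated_grid_law n (A : set R) : measurable A ->
  P (Zn n @^-1` A) = (\int[leb]_y ((w y)%:E * G A (grid_time n (grid n y))))%E.
Proof.
move=> mA.
have mF k : measurable (B1 (grid_time n k) @^-1` A `&` B2 t @^-1` cell n k).
  apply: measurableI; rewrite -[X in measurable X]setTI.
    by apply: measurable_B1 => //; exact: ltW (grid_time_gt0 _ _).
  by apply: measurable_B2 => //; [exact: ltW|exact: measurable_cell].
have -> : Zn n @^-1` A = \bigcup_k (B1 (grid_time n k) @^-1` A `&` B2 t @^-1` cell n k).
  apply/seteqP; split => [v Ao|v [k _ [] /= Ao ko]].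
    by exists (grid n (B2 t v)).
  by rewrite /Zn /= ko.
rewrite measure_semi_bigcup//; last 2 first.
- by move=> i j _ _ [v [] [] _ /= <- [] _ /= <-].
- exact: bigcupT_measurable.
rewrite -(bigcup_cell n) ge0_integral_bigcup//=; first last.
- exact: trivIset_cell.
- by move=> y _; rewrite mule_ge0// lee_fin normal_pdf_ge0.
- by rewrite bigcup_cell; exact: mG.
- exact: measurable_cell.
apply: eq_eseriesr => k _.
rewrite independent_marginals ?(ltW t0) ?(ltW (grid_time_gt0 _ _))//; last first.
  exact: measurable_cell.
rewrite (brownian_motion_law hB1 (grid_time_gt0 _ _) mA).
rewrite (brownian_motion_law hB2 t0 (measurable_cell _ _)) mul0r muleC.
have mw : measurable_fun (cell n k) (fun y => (w y)%:E).
  by apply: measurable_funTS; apply/measurable_EFinP; exact: measurable_normal_pdf.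
have w0 y : cell n k y -> (0 <= (w y)%:E)%E.
  by move=> _; rewrite lee_fin normal_pdf_ge0.
have G0 : (0 <= G A (grid_time n k))%E by exact: measure_ge0.
have NE : normal_prob 0 (Num.sqrt t) (cell n k) = (\int[leb]_(y in cell n k) (w y)%:E)%E.
  by [].
have E := @ge0_integralZr _ _ _ leb _ (measurable_cell n k) _ mw _ w0 G0.
rewrite NE; transitivity (\int[leb]_(y in cell n k) ((w y)%:E * G A (grid_time n k)))%E.
  by rewrite E.
by apply: eq_integral => y; rewrite inE /cell /= => ->.
Qed.

(** Dominated convergence under the weight [w], since probabilities are at most [1]. The point
    [y = 0] is removed because the limiting time [|y|] must be positive in [normal_prob_cvg]. *)
Lemma subordinated_grid_cvg (A : set R) (a : R) : measurable A -> off_boundary A a ->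
  P (Zn n @^-1` A) @[n --> \oo] --> (\int[leb]_(x in A) (p_I m x t)%:E)%E.
Proof.
move=> mA Aa; rewrite (funext (fun n => subordinated_grid_law n mA)).
rewrite integral_p_I_set//.
pose f n y := ((w y)%:E * G A (grid_time n (grid n y)))%E.
pose f0 y := ((w y)%:E * G A `|y|)%E.
have mD : measurable ([set: R] `\ 0) by exact: measurableD.
have mf n : measurable_fun ([set: R] `\ 0) (f n) by apply: measurable_funTS; exact: mG.
have ff0 y : ([set: R] `\ 0) y -> f n y @[n --> \oo] --> f0 y.
  move=> [_ /eqP y0]; apply: cvgeZl => //.
  apply: (normal_prob_cvg mA Aa); first by rewrite normr_gt0.
    by move=> n; exact: grid_time_gt0.
  exact: grid_time_cvg.
have mf0 : measurable_fun ([set: R] `\ 0) f0 by exact: emeasurable_fun_cvg mf ff0.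
have fb n y : ([set: R] `\ 0) y -> (`|f n y| <= (EFin \o w) y)%E.
  move=> _; rewrite gee0_abs; last by rewrite mule_ge0// lee_fin normal_pdf_ge0.
  rewrite -[leRHS]mule1 lee_wpmul2l// ?lee_fin ?normal_pdf_ge0//.
  exact: probability_le1.
suff : (\int[leb]_y f n y @[n --> \oo] --> \int[leb]_y f0 y)%E by exact.
clearbody f f0.
rewrite -(@integral_setD1 R f0 0 setT mD mf0).
rewrite -(funext (fun n => @integral_setD1 R (f n) 0 setT mD (mf n))).
apply: (@dominated_cvg _ _ _ leb _ mD f f0 (EFin \o w)) => //.
by apply: (@integrableS _ _ _ _ setT) => //; exact: integrable_normal_pdf.
Qed.

Let measurable_Z_preimage (A : set R) : measurable A -> measurable (Z @^-1` A).
Proof.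
by move=> mA; rewrite -[X in measurable X]setTI; exact: measurable_subordinated.
Qed.

(** When [Z] lies in the open set [A], so does [Zn n] eventually; hence the probability that both
    lie in [A] tends to that of [Z] in [A], while it is bounded by that of [Zn n] in [A]. *)
Lemma subordinated_open_le (A : set R) (a : R) : open A -> off_boundary A a ->
  (P (Z @^-1` A) <= \int[leb]_(x in A) (p_I m x t)%:E)%E.
Proof.
move=> oA Aa; have mA : measurable A by exact: open_measurable.
have mE := measurable_Z_preimage mA.
have mEn n : measurable (Zn n @^-1` A).
  by rewrite -[X in measurable X]setTI; exact: measurable_Zn.
have h : P (Zn n @^-1` A `&` Z @^-1` A) @[n --> \oo] --> P (Z @^-1` A).
  apply: (@cvg_probability_sets _ _ _ _ _ _ set0) => //.
  - by move=> n; exact: measurableI.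
  - move=> v _; have [ZA|ZA] := pselect (A (Z v)).
      have nA : \forall n \near \oo, A (Zn n v).
        by apply: (@cvg_Zn v A); exact: open_nbhs_nbhs.
      by apply: filterS nA => n An; split.
    by apply: nearW => n; split => [[]|].
apply: (lee_cvg_to h (subordinated_grid_cvg mA Aa)).
by apply: nearW => n; apply: le_measure; rewrite ?inE//; exact: measurableI.
Qed.

Lemma adde_eq1_le (x y u v : \bar R) : (x + y = 1 -> u + v = 1 -> v <= y ->
  0 <= x -> 0 <= u -> x <= u)%E.
Proof.
case: x y u v => [x| |] [y| |] [u| |] [v| |] //; rewrite -!EFinD !lee_fin => -[xy] [uv].
by move=> *; lra.
Qed.

Lemma subordinated_law (A : set R) : measurable A ->
  P (Z @^-1` A) = (\int[leb]_(x in A) (p_I m x t)%:E)%E.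
Proof.
apply: probability_eq_on_rays A.
- exact: measurable_subordinated.
- exact: measurable_p_I.
- by move=> x; exact: p_I_ge0.
move=> a.
have mp (B : set R) : measurable_fun B (fun x => (p_I m x t)%:E).
  by apply: measurable_funTS; apply/measurable_EFinP; exact: measurable_p_I.
have p0 x : (0 <= (p_I m x t)%:E)%E by rewrite lee_fin p_I_ge0.
apply/eqP; rewrite eq_le; apply/andP; split.
  by apply: (subordinated_open_le (a := a)) => //; exact: off_boundary_gt.
(* The reverse inequality on closed right rays comes from the upper bound on the complementary open
   left rays, both measures having total mass [1]. *)
have ge_le b : (\int[leb]_(x in `[b, +oo[) (p_I m x t)%:E <=
    P (Z @^-1` `[b, +oo[%classic))%E.
  have bC : `[b, +oo[%classic = ~` `]-oo, b[%classic :> set R by rewrite setCitvl.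
  apply: (@adde_eq1_le (\int[leb]_(x in `[b, +oo[) (p_I m x t)%:E)%E
    (\int[leb]_(x in `]-oo, b[) (p_I m x t)%:E)%E _ (P (Z @^-1` `]-oo, b[%classic))).
  - rewrite -ge0_integral_setU//= bC.
    + by rewrite setvU integral_p_I.
    + exact: mp.
    + by apply/disj_setPS; rewrite setICl.
  - rewrite bC -preimage_setC -measureU ?setvU ?setICl//.
    + exact: probability_setT.
    + by apply: measurableC; exact: measurable_Z_preimage.
    + exact: measurable_Z_preimage.
  - by apply: (subordinated_open_le (a := b)) => //; exact: off_boundary_lt.
  - by apply: integral_ge0.
  - by [].
(* The open ray is the increasing union of these closed rays, which carries the lower bound over to
   it. *)
have h : (\int[leb]_(x in `[(a + k.+1%:R^-1)%R, +oo[) (p_I m x t)%:E @[k --> \oo] -->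
    \int[leb]_(x in `]a, +oo[) (p_I m x t)%:E)%E.
  rewrite itvoyEbigcup; apply: ge0_nondecreasing_set_cvg_integral => //; last first.
    by move=> i; exact: mp.
  move=> i j ij; apply/subsetPset/subset_itvr.
  by rewrite bnd_simp lerD2l lef_pV2 ?posrE ?ltr0n// ler_nat.
apply: (lee_cvg_to h (cvg_cst _)).
apply: nearW => n; apply: le_trans (ge_le _) _.
apply: le_measure; rewrite ?inE; try exact: measurable_Z_preimage.
move=> v /=; rewrite !in_itv/= !andbT; apply: lt_le_trans.
by rewrite ltrDl invr_gt0 ltr0n.
Qed.

End subordinated_law.

(** * The equation *)

(** Each [gderiv] contributes a minus sign: two cancel in the second-order term, and one reverses
    the sign of the drift, giving the formal adjoint. *)
Lemma drift_opE (R : realType) (m : R) (u : genfun) (h : R -> R) :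
  drift_op m u h = 2^-1 * u (derive1 (derive1 h)) + m * u (derive1 h).
Proof.
transitivity (2^-1 * - - u (derive1 (derive1 h)) - m * - u (derive1 h)); first by [].
by rewrite opprK mulrN opprK.
Qed.

Lemma heat_avg_drift_generator (R : realType) (m : R) (h : R -> R) (t : R) :
  smooth_cs h -> heat_avg m (drift_generator m h) t =
  2^-1 * heat_avg m (derive1 (derive1 h)) t + m * heat_avg m (derive1 h) t.
Proof.
by move=> /smooth_cs_derive1 sh; exact: heat_avg_lin (smooth_cs_derive1 sh) sh.
Qed.

Lemma drift_op_heat_avg (R : realType) (m t : R) (u : genfun) (h : R -> R) :
  (forall g, smooth_cs g -> u g = heat_avg m g t) -> smooth_cs h ->
  drift_op m u h = heat_avg m (drift_generator m h) t.
Proof.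
move=> uE sh; have s1 := smooth_cs_derive1 sh; have s2 := smooth_cs_derive1 s1.
rewrite drift_opE heat_avg_drift_generator//.
by congr (_ * _ + _ * _); exact: uE.
Qed.

(** Unfolding the outer operator evaluates the inner one at [h'] and [h'']; these derivatives then
    commute with [drift_generator m]. *)
Lemma drift_op2_heat_avg (R : realType) (m t : R) (u : genfun) (h : R -> R) :
  (forall g, smooth_cs g -> u g = heat_avg m g t) -> smooth_cs h ->
  drift_op m (drift_op m u) h =
  heat_avg m (drift_generator m (drift_generator m h)) t.
Proof.
move=> uE sh; have s1 := smooth_cs_derive1 sh; have s2 := smooth_cs_derive1 s1.
rewrite drift_opE; apply: etrans; last first.
  exact/esym/heat_avg_drift_generator/smooth_cs_drift_generator.
rewrite (derive1_drift_generator m sh) (derive1_drift_generator m s1).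
by congr (_ * _ + _ * _); exact: drift_op_heat_avg.
Qed.

Theorem theorem2p1 (R : realType) (d : measure_display) (T : measurableType d)
    (P : probability T R) (mu : R) (B1 B2 : R -> T -> R)
    (hB1 : brownian_motion P mu B1) (hB2 : brownian_motion P 0 B2)
    (hB12 : independent_processes P B1 B2) :
  let p (x t : R) : R := p_I mu x t in
  let U (t : R) : genfun := regular (fun x => p x t) in
  (forall t, 0 < t ->
     has_density P (fun w => B1 `|B2 t w| w) (fun x => p x t)) /\
  (forall t, 0 < t ->
     locally_integrable setT (fun x => p x t) /\
     is_time_gderiv U t
       (2^-1 *: drift_op mu (drift_op mu (U t)) +
        (Num.sqrt (2 * pi * t))^-1 *: drift_op mu delta)) /\
  initial_gvalue U delta.
Proof.
move=> p U; split; [|split].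
- move=> t t0; split.
  + exact: (measurable_subordinated hB1 hB2 t0).
  + exact: measurable_p_I.
  + by move=> x; exact: p_I_ge0.
  + by move=> A mA; exact: (subordinated_law hB1 hB2 hB12 t0 mA).
- move=> t t0; split.
    split; [exact: measurable_p_I|exact: openT|move=> K _ cK].
    have mK := compact_measurable cK.
    suff /integrableP[] : lebesgue_measure.-integrable K (EFin \o (fun x => p_I mu x t)).
      by [].
    by apply: (@integrableS _ _ _ _ setT) => //; exact: integrable_p_I.
  move=> phi /test_function_smooth_cs sphi.
  (* The pairing is known to equal [heat_avg] at positive times only, which suffices for a
     derivative at [t > 0]. *)
  apply: (@near_eq_is_derive _ _ _ (heat_avg mu phi)).
    near=> s; rewrite /U /p regular_p_I//.
    by near: s; exact: lt_nbhsr.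
  have := is_derive_heat_avg mu sphi t0; move/is_derive_eq; apply.
  have UE h : smooth_cs h -> U t h = heat_avg mu h t by exact: regular_p_I.
  transitivity (2^-1 * drift_op mu (drift_op mu (U t)) phi +
    (Num.sqrt (2 * pi * t))^-1 * drift_op mu delta phi); last by [].
  by rewrite (drift_op2_heat_avg UE sphi) (drift_opE mu delta).
- move=> phi /test_function_smooth_cs sphi.
  (* [heat_avg mu phi] is continuous at [0] with value [phi 0], and it agrees with the pairing on
     [t > 0], along which the limit is taken. *)
  have h : heat_avg mu phi t @[t --> 0^'+] --> phi 0.
    rewrite -(heat_avg0 mu sphi); apply: cvg_at_right_filter.
    exact: heat_avg_continuous.
  apply: cvg_trans h; apply: near_eq_cvg; near=> t.
  rewrite /U /p regular_p_I//; near: t; exact: nbhs_right_gt.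
Unshelve. all: by end_near. Qed.
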